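(* Let $R$ be a commutative artinian ring and let $(\mathcal{A},\mathbb{E},\mathfrak{s})$ be an artin $R$-linear extriangulated category. Let $(\Phi,Q)=(\{\Phi_i\}_{i=1}^n,\{Q_i\}_{i=1}^n)$ be a minimal projective $\mathbb{E}$-stratifying system in $(\mathcal{A},\mathbb{E},\mathfrak{s})$ and suppose that $\mathcal{A}(Q_i,-)$ is left exact on $(\mathcal{F}(\Phi),\mathbb{E}|_{\mathcal{F}(\Phi)},\mathfrak{s}|_{\mathcal{F}(\Phi)})$ for each $1\le i\le n$. Then, up to isomorphism, the collection of $(\mathbb{E}|_{\mathcal{F}(\Phi)},\mathfrak{s}|_{\mathcal{F}(\Phi)})$-simple objects is precisely the set $\Phi$, and hence $(\mathcal{F}(\Phi),\mathbb{E}|_{\mathcal{F}(\Phi)},\mathfrak{s}|_{\mathcal{F}(\Phi)})$ is a length and Jordan-Hölder extriangulated category.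
   Context: **Extriangulated category** (Nakaoka--Palu): a triple $(\mathcal{A},\mathbb{E},\mathfrak{s})$ with $\mathcal{A}$ an additive category, $\mathbb{E}\colon\mathcal{A}^{\mathrm{op}}\times\mathcal{A}\to\mathsf{Ab}$ a biadditive functor, and $\mathfrak{s}$ as follows. Elements $\delta\in\mathbb{E}(C,A)$ are extensions; for $x\colon A\to A'$, $z\colon C'\to C$ put $x_*\delta=\mathbb{E}(C,x)(\delta)$, $z^*\delta=\mathbb{E}(z,A)(\delta)$. A morphism of extensions from $\delta\in\mathbb{E}(C,A)$ to $\delta'\in\mathbb{E}(C',A')$ is a pair $(f\colon A\to A',h\colon C\to C')$ with $f_*\delta=h^*\delta'$. The sum $\delta\oplus\delta'\in\mathbb{E}(C\oplus C',A\oplus A')$ corresponds to $(\delta,0,0,\delta')$. Sequences $A\to B\to C$ and $A\to B'\to C$ are equivalent if there is an isomorphism $B\to B'$ commuting with identities on $A$ and $C$. To each $\delta\in\mathbb{E}(C,A)$, $\mathfrak{s}$ assigns an equivalence class $\mathfrak{s}(\delta)=[A\xrightarrow{a}B\xrightarrow{b}C]$ such that: every morphism of extensions $(f,h)\colon\delta\to\delta'$ is completed by some $g$ with $ga=a'f$, $hb=b'g$; $\mathfrak{s}(0)$ is the class of the split sequence $A\to A\oplus C\to C$; $\mathfrak{s}(\delta\oplus\delta')=\mathfrak{s}(\delta)\oplus\mathfrak{s}(\delta')$. If $\mathfrak{s}(\delta)=[A\xrightarrow{a}B\xrightarrow{b}C]$, then $A\xrightarrow{a}B\xrightarrow{b}C\overset{\delta}{\dashrightarrow}$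 is called an extriangle, $a$ an inflation and $b$ a deflation. Axioms: (ET3) for two extriangles and $f,g$ with $ga=a'f$ there is $h$ with $hb=b'g$ and $(f,h)$ a morphism of extensions; (ET4) for extriangles $A\xrightarrow{f}B\xrightarrow{f'}D\overset{\delta}{\dashrightarrow}$ and $B\xrightarrow{g}C\xrightarrow{g'}F\overset{\delta'}{\dashrightarrow}$ there are an extriangle $A\xrightarrow{gf}C\xrightarrow{h'}E\overset{\delta''}{\dashrightarrow}$ and morphisms $d\colon D\to E$, $e\colon E\to F$ with $df'=h'g$, $eh'=g'$, $D\xrightarrow{d}E\xrightarrow{e}F\overset{f'_*\delta'}{\dashrightarrow}$ an extriangle, $d^*\delta''=\delta$, $f_*\delta''=e^*\delta'$; and the duals (ET3)$^{\mathrm{op}}$, (ET4)$^{\mathrm{op}}$. **Artin $R$-linear extriangulated category** ($R$ commutative artinian): $\mathcal{A}$ is $R$-linear, $\mathbb{E}$ takes values in $R$-modules and is $R$-bilinear, $\mathcal{A}$ is idempotent complete, and all $\mathcal{A}(X,Y)$ and $\mathbb{E}(X,Y)$ are finite length $R$-modules. **Filtrations.** For a class $\mathcal{X}$ of objects, an $\mathcal{X}$-filtration of $M$ of length $t\ge 0$ is a sequence $(\xi_0,\dots,\xi_t)$ of extriangles $M_{i-1}\to M_i\to X_i\overset{\xi_i}{\dashrightarrow}$ with $M_{-1}=M_0=X_0=0$, $M_t=M$, and $X_i\in\mathcal{X}$ for $1\le i\le t$ (the factors). $\mathcal{F}(\mathcal{X})$ is the full subcategory of objects admitting an $\mathcal{X}$-filtration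 ($\mathcal{F}(\emptyset)=\{0\}$). It is extension-closed in $\mathcal{A}$, hence is itself an extriangulated category with the restrictions $\mathbb{E}|_{\mathcal{F}(\mathcal{X})}$, $\mathfrak{s}|_{\mathcal{F}(\mathcal{X})}$; its extriangles are the extriangles of $\mathcal{A}$ with all three terms in $\mathcal{F}(\mathcal{X})$. **$\mathbb{E}$-stratifying system**: a finite collection $\Phi=\{\Phi_1,\dots,\Phi_n\}$ of indecomposable objects of $\mathcal{A}$ with (S1) $\mathcal{A}(\Phi_j,\Phi_i)=0$ whenever $j>i$, and (S2) $\mathbb{E}(\Phi_j,\Phi_i)=0$ whenever $j\ge i$. **Projective $\mathbb{E}$-stratifying system**: a pair $(\Phi,Q)$ with $\Phi=\{\Phi_i\}_{i=1}^n$ an $\mathbb{E}$-stratifying system and $Q=\{Q_i\}_{i=1}^n$ a set of objects of $\mathcal{A}$ (some $Q_i$ may be zero) such that (PS1) $\mathbb{E}(Q_i,\Phi_j)=0$ for all $1\le i,j\le n$; (PS2) for each $i$ there is an extriangle $K_i\xrightarrow{k_i}Q_i\xrightarrow{q_i}\Phi_i\overset{\eta_i}{\dashrightarrow}$ with $K_i\in\mathcal{F}(\{\Phi_j\mid j>i\})$. It is **minimal** if each $q_i$ is right minimal, i.e. every endomorphism $g$ of $Q_i$ with $q_ig=q_i$ is an automorphism. **Left exactness**: an additive functor $F\colon\mathcal{A}'\to\mathsf{Ab}$ is left exact on an extriangulated category $(\mathcal{A}',\mathbb{E}',\mathfrak{s}')$ if for each extriangle $A\xrightarrow{a}B\xrightarrow{b}C\dashrightarrow$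 the map $Fa\colon FA\to FB$ is injective. **Simple, length, Jordan-Hölder.** In an extriangulated category $(\mathcal{A}',\mathbb{E}',\mathfrak{s}')$, a non-zero object $S$ is $(\mathbb{E}',\mathfrak{s}')$-simple if for every extriangle $A\xrightarrow{a}S\to C\dashrightarrow$ either $a=0$ or $a$ is an isomorphism. An $(\mathbb{E}',\mathfrak{s}')$-composition series of $M$ of length $t\ge 0$ is a sequence $(\xi_0,\dots,\xi_t)$ of extriangles $M_{i-1}\to M_i\to X_i\overset{\xi_i}{\dashrightarrow}$ in $(\mathcal{A}',\mathbb{E}',\mathfrak{s}')$ with $M_{-1}=M_0=X_0=0$, $M_t=M$, and $X_i$ an $(\mathbb{E}',\mathfrak{s}')$-simple object for each $1\le i\le t$; the objects $X_1,\dots,X_t$ are its factors. The category is length if each object has a composition series and, for each object, the set of lengths of all its composition series is bounded. It is Jordan-Hölder if any two composition series of the same object have the same length and, up to a permutation of indices, isomorphic factors. *)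

(* Defs.v *)
From mathcomp Require Import all_boot ssralg perm.

Set Implicit Arguments.
Unset Strict Implicit.
Unset Printing Implicit Defensive.

Import GRing.Theory.
Local Open Scope ring_scope.

Section Modules.
Variable (R : comPzRingType) (M : lmodType R).

Record is_submodule (N : M -> Prop) : Prop := IsSubmodule {
  submodule0 : N 0;
  submoduleD : forall x y, N x -> N y -> N (x + y);
  submoduleZ : forall r x, N x -> N (r *: x)
}.

Definition subpredicate (N L : M -> Prop) : Prop := forall x, N x -> L x.

(* A chain 0 = N_0 < N_1 < ... < N_l = M of submodules with simple
   subquotients; the values of N above l are irrelevant. *)
Definition finite_length : Prop :=
  exists (l : nat) (N : nat -> M -> Prop),
    [/\ forall i, (i <= l)%N -> is_submodule (N i),
        forall x, N 0%N x <-> x = 0,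
        forall x, N l x
      & forall i, (i < l)%N ->
          [/\ subpredicate (N i) (N i.+1),
              ~ subpredicate (N i.+1) (N i)
            & forall L, is_submodule L ->
                subpredicate (N i) L -> subpredicate L (N i.+1) ->
                subpredicate L (N i) \/ subpredicate (N i.+1) L]].

End Modules.

Definition artinian_ring (R : comPzRingType) : Prop :=
  forall I : nat -> R^o -> Prop,
    (forall k, is_submodule (I k)) ->
    (forall k, subpredicate (I k.+1) (I k)) ->
    exists m, forall k, (m <= k)%N -> subpredicate (I m) (I k).

(* The data and the laws are kept apart, so that the restriction of the data to
   an arbitrary full subcategory is defined without proof obligations.
   [ext C A] is E(C, A), [push x d] is x_* d, and [pull z d] is z^* d.
   [extriangle d a b] says that A -a-> B -b-> C belongs to the class s(d). *)
Record extri_data (R : comPzRingType) : Type := ExtriData {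
  obj : Type;
  hom : obj -> obj -> lmodType R;
  idm : forall A, hom A A;
  mcomp : forall A B C, hom B C -> hom A B -> hom A C;
  ext : obj -> obj -> lmodType R;
  push : forall C A A', hom A A' -> ext C A -> ext C A';
  pull : forall C C' A, hom C' C -> ext C A -> ext C' A;
  extriangle : forall A B C, ext C A -> hom A B -> hom B C -> Prop
}.

Arguments hom {R e} _ _.
Arguments idm {R e} _.
Arguments ext {R e} _ _.

Declare Scope extri_scope.
Delimit Scope extri_scope with X.
Notation "g ** f" := (mcomp g f) (at level 40, left associativity) : extri_scope.
Local Open Scope extri_scope.

Section Notions.
Variables (R : comPzRingType) (D : extri_data R).

Definition is_zero (X : obj D) : Prop :=
  forall Y, (forall f : hom X Y, f = 0) /\ (forall g : hom Y X, g = 0).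

Definition is_iso (X Y : obj D) (f : hom X Y) : Prop :=
  exists g : hom Y X, g ** f = idm X /\ f ** g = idm Y.

Definition isomorphic (X Y : obj D) : Prop := exists f : hom X Y, is_iso f.

Record is_biproduct (A B P : obj D) (i1 : hom A P) (i2 : hom B P)
    (p1 : hom P A) (p2 : hom P B) : Prop := IsBiproduct {
  biprod_11 : p1 ** i1 = idm A;
  biprod_22 : p2 ** i2 = idm B;
  biprod_12 : p1 ** i2 = 0;
  biprod_21 : p2 ** i1 = 0;
  biprod_id : i1 ** p1 + i2 ** p2 = idm P
}.

Definition indecomposable (X : obj D) : Prop :=
  ~ is_zero X /\
  forall A B (i1 : hom A X) (i2 : hom B X) (p1 : hom X A) (p2 : hom X B),
    is_biproduct i1 i2 p1 p2 -> is_zero A \/ is_zero B.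

Definition idempotent_complete : Prop :=
  forall (X : obj D) (e : hom X X), e ** e = e ->
    exists (Y : obj D) (p : hom X Y) (i : hom Y X),
      p ** i = idm Y /\ i ** p = e.

Record is_linear_category : Prop := IsLinearCategory {
  mcompA : forall (A B C E : obj D) (h : hom C E) (g : hom B C) (f : hom A B),
    h ** (g ** f) = h ** g ** f;
  mcomp1m : forall (A B : obj D) (f : hom A B), idm B ** f = f;
  mcompm1 : forall (A B : obj D) (f : hom A B), f ** idm A = f;
  mcomp_linearr : forall (A B C : obj D) (g : hom B C),
    linear (fun f : hom A B => g ** f);
  mcomp_linearl : forall (A B C : obj D) (f : hom A B),
    linear (fun g : hom B C => g ** f)
}.

Record is_additive : Prop := IsAdditive {
  has_zero : exists Z : obj D, is_zero Z;
  has_biproducts : forall A B : obj D,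
    exists P (i1 : hom A P) (i2 : hom B P) (p1 : hom P A) (p2 : hom P B),
      is_biproduct i1 i2 p1 p2
}.

Record is_linear_bifunctor : Prop := IsLinearBifunctor {
  push1 : forall (C A : obj D) (d : ext C A), push (idm A) d = d;
  pushM : forall (C A A' A'' : obj D) (y : hom A' A'') (x : hom A A')
    (d : ext C A), push (y ** x) d = push y (push x d);
  pull1 : forall (C A : obj D) (d : ext C A), pull (idm C) d = d;
  pullM : forall (C C' C'' A : obj D) (z : hom C' C) (w : hom C'' C')
    (d : ext C A), pull (z ** w) d = pull w (pull z d);
  push_pull : forall (C C' A A' : obj D) (x : hom A A') (z : hom C' C)
    (d : ext C A), push x (pull z d) = pull z (push x d);
  push_linearr : forall (C A A' : obj D) (x : hom A A'),
    linear (fun d : ext C A => push x d);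
  pull_linearr : forall (C C' A : obj D) (z : hom C' C),
    linear (fun d : ext C A => pull z d);
  push_linearl : forall (C A A' : obj D) (d : ext C A),
    linear (fun x : hom A A' => push x d);
  pull_linearl : forall (C C' A : obj D) (d : ext C A),
    linear (fun z : hom C' C => pull z d)
}.

Definition ext_morphism (A C A' C' : obj D) (d : ext C A) (d' : ext C' A')
    (f : hom A A') (h : hom C C') : Prop :=
  push f d = pull h d'.

Definition equiv_seq (A B B' C : obj D) (a : hom A B) (b : hom B C)
    (a' : hom A B') (b' : hom B' C) : Prop :=
  exists g : hom B B', [/\ is_iso g, g ** a = a' & b' ** g = b].

(* f (+) f' : A (+) A' -> B (+) B', from the projections of the source and the
   injections of the target *)
Definition sum_hom (A A' P B B' S : obj D) (p1 : hom P A) (p2 : hom P A')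
    (j1 : hom B S) (j2 : hom B' S) (f : hom A B) (f' : hom A' B') : hom P S :=
  j1 ** f ** p1 + j2 ** f' ** p2.

(* The element of E(C (+) C', A (+) A') with components (d, 0, 0, d'), from the
   projections of C (+) C' and the injections of A (+) A' *)
Definition sum_ext (C C' S A A' P : obj D) (q1 : hom S C) (q2 : hom S C')
    (i1 : hom A P) (i2 : hom A' P) (d : ext C A) (d' : ext C' A') : ext S P :=
  push i1 (pull q1 d) + push i2 (pull q2 d').

(* The first three fields say that [extriangle d] is exactly one equivalence
   class of sequences. *)
Record is_additive_realization : Prop := IsAdditiveRealization {
  real_ex : forall (A C : obj D) (d : ext C A),
    exists B (a : hom A B) (b : hom B C), extriangle d a b;
  real_uniq : forall (A B B' C : obj D) (d : ext C A)
    (a : hom A B) (b : hom B C) (a' : hom A B') (b' : hom B' C),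
    extriangle d a b -> extriangle d a' b' -> equiv_seq a b a' b';
  real_equiv : forall (A B B' C : obj D) (d : ext C A)
    (a : hom A B) (b : hom B C) (a' : hom A B') (b' : hom B' C),
    extriangle d a b -> equiv_seq a b a' b' -> extriangle d a' b';
  real_morphism : forall (A B C A' B' C' : obj D)
    (d : ext C A) (a : hom A B) (b : hom B C)
    (d' : ext C' A') (a' : hom A' B') (b' : hom B' C')
    (f : hom A A') (h : hom C C'),
    extriangle d a b -> extriangle d' a' b' -> ext_morphism d d' f h ->
    exists g : hom B B', g ** a = a' ** f /\ h ** b = b' ** g;
  real_split : forall (A C P : obj D) (i1 : hom A P) (i2 : hom C P)
    (p1 : hom P A) (p2 : hom P C),
    is_biproduct i1 i2 p1 p2 -> extriangle (0 : ext C A) i1 p2;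
  real_sum : forall (A B C A' B' C' : obj D)
    (d : ext C A) (a : hom A B) (b : hom B C)
    (d' : ext C' A') (a' : hom A' B') (b' : hom B' C')
    (SA SB SC : obj D)
    (iA : hom A SA) (iA' : hom A' SA) (pA : hom SA A) (pA' : hom SA A')
    (iB : hom B SB) (iB' : hom B' SB) (pB : hom SB B) (pB' : hom SB B')
    (iC : hom C SC) (iC' : hom C' SC) (pC : hom SC C) (pC' : hom SC C'),
    is_biproduct iA iA' pA pA' -> is_biproduct iB iB' pB pB' ->
    is_biproduct iC iC' pC pC' ->
    extriangle d a b -> extriangle d' a' b' ->
    extriangle (sum_ext pC pC' iA iA' d d')
      (sum_hom pA pA' iB iB' a a') (sum_hom pB pB' iC iC' b b')
}.

Definition ET3 : Prop :=
  forall (A B C A' B' C' : obj D)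
    (d : ext C A) (a : hom A B) (b : hom B C)
    (d' : ext C' A') (a' : hom A' B') (b' : hom B' C')
    (f : hom A A') (g : hom B B'),
    extriangle d a b -> extriangle d' a' b' -> g ** a = a' ** f ->
    exists h : hom C C', h ** b = b' ** g /\ ext_morphism d d' f h.

Definition ET3op : Prop :=
  forall (A B C A' B' C' : obj D)
    (d : ext C A) (a : hom A B) (b : hom B C)
    (d' : ext C' A') (a' : hom A' B') (b' : hom B' C')
    (g : hom B B') (h : hom C C'),
    extriangle d a b -> extriangle d' a' b' -> h ** b = b' ** g ->
    exists f : hom A A', g ** a = a' ** f /\ ext_morphism d d' f h.

Definition ET4 : Prop :=
  forall (A B C D' F : obj D)
    (f : hom A B) (f' : hom B D') (d1 : ext D' A)
    (g : hom B C) (g' : hom C F) (d2 : ext F B),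
    extriangle d1 f f' -> extriangle d2 g g' ->
    exists (E : obj D) (h' : hom C E) (d3 : ext E A)
      (d : hom D' E) (e : hom E F),
      [/\ extriangle d3 (g ** f) h',
          d ** f' = h' ** g /\ e ** h' = g',
          extriangle (push f' d2) d e,
          pull d d3 = d1
        & push f d3 = pull e d2].

Definition ET4op : Prop :=
  forall (A B C D' F : obj D)
    (f' : hom D' B) (f : hom B A) (d1 : ext A D')
    (g' : hom F C) (g : hom C B) (d2 : ext B F),
    extriangle d1 f' f -> extriangle d2 g' g ->
    exists (E : obj D) (h' : hom E C) (d3 : ext A E)
      (d : hom E D') (e : hom F E),
      [/\ extriangle d3 h' (f ** g),
          f' ** d = g ** h' /\ h' ** e = g',
          extriangle (pull f' d2) e d,
          push d d3 = d1
        & pull f d3 = push e d2].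

Record is_extriangulated : Prop := IsExtriangulated {
  extri_category : is_linear_category;
  extri_additive : is_additive;
  extri_bifunctor : is_linear_bifunctor;
  extri_realization : is_additive_realization;
  extri_ET3 : ET3;
  extri_ET3op : ET3op;
  extri_ET4 : ET4;
  extri_ET4op : ET4op
}.

Record is_artin_extriangulated : Prop := IsArtinExtriangulated {
  artin_extriangulated : is_extriangulated;
  artin_idempotent_complete : idempotent_complete;
  artin_hom : forall X Y : obj D, finite_length (hom X Y);
  artin_ext : forall X Y : obj D, finite_length (ext X Y)
}.

(* M_i = N i for 0 <= i <= t and X_i = F i for 1 <= i <= t; the other values of
   N and F are irrelevant, and the extriangle 0 -> 0 -> 0 of index 0 carries no
   information. *)
Definition filtration (X : obj D -> Prop) (M : obj D) (t : nat)
    (N F : nat -> obj D) : Prop :=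
  [/\ is_zero (N 0%N), N t = M
    & forall i, (1 <= i <= t)%N ->
        X (F i) /\
        exists (xi : ext (F i) (N i.-1)) (a : hom (N i.-1) (N i))
          (b : hom (N i) (F i)), extriangle xi a b].

Definition filt (X : obj D -> Prop) (M : obj D) : Prop :=
  exists (t : nat) (N F : nat -> obj D), filtration X M t N F.

Definition simple (S : obj D) : Prop :=
  ~ is_zero S /\
  forall (A C : obj D) (d : ext C A) (a : hom A S) (b : hom S C),
    extriangle d a b -> a = 0 \/ is_iso a.

Definition composition_series : obj D -> nat -> (nat -> obj D) ->
    (nat -> obj D) -> Prop :=
  filtration simple.

Definition is_length : Prop :=
  forall M : obj D,
    (exists (t : nat) (N F : nat -> obj D), composition_series M t N F) /\
    (exists m : nat, forall (t : nat) (N F : nat -> obj D),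
       composition_series M t N F -> (t <= m)%N).

Definition jordan_holder : Prop :=
  forall (M : obj D) (t t' : nat) (N F N' F' : nat -> obj D),
    composition_series M t N F -> composition_series M t' N' F' ->
    t = t' /\
    exists s : 'S_t, forall i : 'I_t, isomorphic (F i.+1) (F' (s i).+1).

(* For an additive functor to abelian groups, given by its object map G and its
   morphism map Gm; the functor laws play no role in the condition. *)
Definition left_exact (G : obj D -> zmodType)
    (Gm : forall X Y, hom X Y -> G X -> G Y) : Prop :=
  forall (A B C : obj D) (d : ext C A) (a : hom A B) (b : hom B C),
    extriangle d a b -> injective (Gm A B a).

Definition right_minimal (X Y : obj D) (q : hom X Y) : Prop :=
  forall g : hom X X, q ** g = q -> is_iso g.

Section StratifyingSystems.
Variables (n : nat) (Phi Q : 'I_n -> obj D).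

Record stratifying_system : Prop := StratifyingSystem {
  strat_indec : forall i, indecomposable (Phi i);
  strat_S1 : forall i j : 'I_n, (i < j)%N ->
    forall f : hom (Phi j) (Phi i), f = 0;
  strat_S2 : forall i j : 'I_n, (i <= j)%N ->
    forall d : ext (Phi j) (Phi i), d = 0
}.

Definition PS1 : Prop :=
  forall (i j : 'I_n) (d : ext (Q i) (Phi j)), d = 0.

Definition PS2_extriangle (i : 'I_n) (K : obj D) (k : hom K (Q i))
    (q : hom (Q i) (Phi i)) (eta : ext (Phi i) K) : Prop :=
  extriangle eta k q /\
  filt (fun M => exists2 j : 'I_n, (i < j)%N & M = Phi j) K.

Record projective_stratifying_system : Prop := ProjectiveStratifyingSystem {
  pss_strat : stratifying_system;
  pss_PS1 : PS1;
  pss_PS2 : forall i : 'I_n,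
    exists (K : obj D) (k : hom K (Q i)) (q : hom (Q i) (Phi i))
      (eta : ext (Phi i) K), PS2_extriangle k q eta
}.

(* The extriangles of (PS2) can be chosen with every q_i right minimal. *)
Definition minimal_projective_stratifying_system : Prop :=
  projective_stratifying_system /\
  forall i : 'I_n,
    exists (K : obj D) (k : hom K (Q i)) (q : hom (Q i) (Phi i))
      (eta : ext (Phi i) K), PS2_extriangle k q eta /\ right_minimal q.

End StratifyingSystems.

End Notions.

(* The extriangles of the restriction are those of D with all three terms in
   the subcategory. *)
Definition full_sub (R : comPzRingType) (D : extri_data R)
    (P : obj D -> Prop) : extri_data R :=
  @ExtriData R {X : obj D | P X}
    (fun X Y => hom (sval X) (sval Y))
    (fun X => idm (sval X))
    (fun X Y Z g f => g ** f)
    (fun C A => ext (sval C) (sval A))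
    (fun C A A' x d => push x d)
    (fun C C' A z d => pull z d)
    (fun A B C d a b => extriangle d a b).

Definition filt_sub (R : comPzRingType) (D : extri_data R) (n : nat)
    (Phi : 'I_n -> obj D) : extri_data R :=
  full_sub (filt (fun M => exists i : 'I_n, M = Phi i)).

(* A(Y, -) on the subcategory; the object Y itself ranges over all of D. *)
Definition hom_left_exact (R : comPzRingType) (D : extri_data R) (n : nat)
    (Phi : 'I_n -> obj D) (Y : obj D) : Prop :=
  @left_exact R (filt_sub Phi) (fun X => hom Y (sval X))
    (fun X X' (f : hom (sval X) (sval X')) (g : hom Y (sval X)) => f ** g).

(* Main.v *)
Require Import Defs.
From mathcomp Require Import all_boot ssralg perm.
From mathcomp Require Import boolp.

(** The functors Hom(Q_j, -) are exact on F(Phi): left exactness is assumed, and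
    E(Q_j, F(Phi)) = 0 by induction on filtrations.  Hence the R-length of
    Hom(Q_j, M) is additive on extriangles, and equals the sum of the lengths of
    Hom(Q_j, Phi_k) over the factors Phi_k of any filtration of M.  The matrix of
    these lengths is triangular with positive diagonal (minimality enters here),
    so the multiset of factors of M depends on M only.  An extriangle
    A -> Phi_i -> C in F(Phi) therefore has A = 0 or C = 0, so Phi_i is simple; a
    simple object is isomorphic to the last factor of any of its filtrations; and
    the Jordan-Hölder property follows. *)

Set Implicit Arguments.
Unset Strict Implicit.
Unset Printing Implicit Defensive.

Import GRing.Theory.
Local Open Scope ring_scope.
Local Open Scope extri_scope.

(** * Length of modules: uniqueness, and additivity on short exact sequences *)

Section ModuleLength.
Variable R : comPzRingType.
Implicit Type M : lmodType R.

(** Simplicity of the quotient L/N, said through intermediate submodules so that no quotient module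
    has to be formed. *)
Definition simple_step M (N L : M -> Prop) : Prop :=
  [/\ subpredicate N L, ~ subpredicate L N
    & forall K, is_submodule K -> subpredicate N K -> subpredicate K L ->
        subpredicate K N \/ subpredicate L K].

(** The length is made a parameter: [finite_length M] unfolds to [exists l, has_length M l]. *)
Definition has_length M (l : nat) : Prop :=
  exists N : nat -> M -> Prop,
    [/\ forall i, (i <= l)%N -> is_submodule (N i),
        forall x, N 0%N x <-> x = 0,
        forall x, N l x
      & forall i, (i < l)%N -> simple_step (N i) (N i.+1)].

Lemma submoduleB M (N : M -> Prop) x y :
  is_submodule N -> N x -> N y -> N (x - y).
Proof.
move=> sN Nx Ny; rewrite -scaleN1r.
by apply: submoduleD => //; apply: submoduleZ.
Qed.

Lemma has_length0 M : (forall x : M, x = 0) -> has_length M 0.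
Proof.
move=> M0; by exists (fun _ _ => True); split.
Qed.

Lemma has_length_eq0 M (x : M) : has_length M 0 -> x = 0.
Proof. by case=> N [_ N0 NT _]; apply/N0. Qed.

(* The number of steps of a composition series that meet a submodule is strictly
   monotone in that submodule, so it bounds the length of any strict chain. *)
Lemma has_length_le M l l' : has_length M l -> has_length M l' -> (l' <= l)%N.
Proof.
move=> [N [sN N0 NT stepN]] [N' [sN' _ _ stepN']].
pose met (A : M -> Prop) : {set 'I_l} :=
  [set i : 'I_l | `[< exists x, [/\ A x, N i.+1 x & ~ N i x] >]].
have met_sub A B : subpredicate A B -> met A \subset met B.
  move=> sAB; apply/subsetP=> i; rewrite !inE => /asboolP[x [Ax Nx nx]].
  by apply/asboolP; exists x; split=> //; apply: sAB.
have met_eq A B : is_submodule A -> is_submodule B -> subpredicate A B ->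
    met B \subset met A -> subpredicate B A.
  move=> sA sB sAB /subsetP sBA.
  suff IH i : (i <= l)%N -> forall x, B x -> N i x -> A x.
    by move=> x Bx; apply: (IH l).
  elim: i => [|i IH] il x Bx Nx.
    by move/N0: Nx => ->; apply: submodule0.
  have [Nix|nNix] := EM (N i x); first exact: IH (ltnW il) _ Bx Nix.
  have : Ordinal il \in met A.
    by apply: sBA; rewrite inE; apply/asboolP; exists x.
  rewrite inE => /asboolP[/= y [Ay Ny nNiy]].
  have [sNi _ simp] := stepN i il.
  (* K is the sum of N_i and the intersection of A with N_(i+1). It contains y, so simplicity gives
     K = N_(i+1), whence x = v + w with v in A and w in both B and N_i; induction applies to w. *)
  pose K u := exists v w, [/\ u = v + w, A v, N i.+1 v & N i w].
  have sK : is_submodule K.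
    have sNi0 := sN i (ltnW il); have sNi1 := sN i.+1 il.
    split.
    - by exists 0, 0; rewrite addr0; split=> //; apply: submodule0.
    - move=> u u' [v [w [-> Av Nv Nw]]] [v' [w' [-> Av' Nv' Nw']]].
      exists (v + v'), (w + w'); rewrite addrACA.
      by split=> //; apply: submoduleD.
    - move=> r u [v [w [-> Av Nv Nw]]].
      exists (r *: v), (r *: w); rewrite scalerDr.
      by split=> //; apply: submoduleZ.
  case: (simp K sK).
  - move=> u Nu; exists 0, u; rewrite add0r; split=> //.
      exact: submodule0.
    exact: submodule0 (sN _ il).
  - move=> u [v [w [-> _ Nv Nw]]]; apply: submoduleD (sN _ il) _ _ Nv _.
    exact: sNi.
  - move=> KN; case: nNiy; apply: KN; exists y, 0; rewrite addr0; split=> //.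
    exact: submodule0 (sN _ (ltnW il)).
  move=> NK; have [v [w [xvw Av Nv Nw]]] := NK x Nx.
  rewrite xvw; apply: submoduleD => //; apply: IH (ltnW il) _ _ Nw.
  have -> : w = x - v by rewrite xvw addrC addKr.
  by apply: submoduleB => //; apply: sAB.
suff IH i : (i <= l')%N -> (i <= #|met (N' i)|)%N.
  by apply: leq_trans (IH l' (leqnn _)) _; rewrite -[leqRHS]card_ord max_card.
elim: i => // i IH il; apply: leq_ltn_trans (IH (ltnW il)) _.
have [sub nsub _] := stepN' i il.
rewrite ltn_neqAle subset_leq_card ?met_sub // andbT.
apply/negP=> /eqP eqc; apply: nsub; apply: met_eq => //.
- exact: sN' (ltnW il).
- exact: sN'.
- have := eqEcard (met (N' i)) (met (N' i.+1)).
  by rewrite met_sub //= eqc leqnn => /eqP ->.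
Qed.

Lemma has_length_uniq M l l' : has_length M l -> has_length M l' -> l = l'.
Proof. by move=> h h'; apply/anti_leq; rewrite !(has_length_le (M := M)). Qed.

Lemma linear_0 (U V : lmodType R) (f : U -> V) : linear f -> f 0 = 0.
Proof.
by move/(_ (-1) 0 0); rewrite scaler0 addr0 scaleN1r addNr.
Qed.

Lemma linear_D (U V : lmodType R) (f : U -> V) x y :
  linear f -> f (x + y) = f x + f y.
Proof. by move/(_ 1 x y); rewrite !scale1r. Qed.

Lemma linear_Z (U V : lmodType R) (f : U -> V) r x :
  linear f -> f (r *: x) = r *: f x.
Proof. by move=> lf; have := lf r x 0; rewrite (linear_0 lf) !addr0. Qed.

Lemma linear_B (U V : lmodType R) (f : U -> V) x y :
  linear f -> f (x - y) = f x - f y.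
Proof. by move=> lf; rewrite linear_D // -scaleN1r linear_Z // scaleN1r. Qed.

Section ShortExact.
Variables (A B C : lmodType R) (f : A -> B) (g : B -> C).
Hypotheses (lin_f : linear f) (lin_g : linear g).
Hypotheses (inj_f : injective f) (surj_g : forall z, exists y, g y = z).
Hypothesis ker_g : forall y, g y = 0 <-> exists x, y = f x.

Let im (N : A -> Prop) (y : B) := exists2 x, N x & y = f x.
Let pre (N : C -> Prop) (y : B) := N (g y).

Let submodule_im N : is_submodule N -> is_submodule (im N).
Proof.
move=> sN; split.
- by exists 0; rewrite ?linear_0 //; apply: submodule0.
- move=> _ _ [x Nx ->] [y Ny ->]; exists (x + y); rewrite ?linear_D //.
  exact: submoduleD.
- move=> r _ [x Nx ->]; exists (r *: x); rewrite ?linear_Z //.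
  exact: submoduleZ.
Qed.

Let submodule_pre N : is_submodule N -> is_submodule (pre N).
Proof.
move=> sN; split; rewrite /pre.
- by rewrite linear_0 //; apply: submodule0.
- by move=> x y Nx Ny; rewrite linear_D //; apply: submoduleD.
- by move=> r x Nx; rewrite linear_Z //; apply: submoduleZ.
Qed.

Let step_im N L : simple_step N L -> simple_step (im N) (im L).
Proof.
move=> [sub nsub simp]; split.
- by move=> _ [x Nx ->]; exists x => //; apply: sub.
- move=> h; apply: nsub => x Lx; have [|y Ny /inj_f ->//] := h (f x).
  by exists x.
move=> K sK NK KL; pose K' x := K (f x).
have sK' : is_submodule K'.
  split; rewrite /K'.
  - by rewrite linear_0 //; apply: submodule0.
  - by move=> x y Kx Ky; rewrite linear_D //; apply: submoduleD.
  - by move=> r x Kx; rewrite linear_Z //; apply: submoduleZ.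
case: (simp K' sK').
- by move=> x Nx; apply: NK; exists x.
- by move=> x /KL[y Ly /inj_f ->].
- by move=> h; left=> y Ky; have [x _ yE] := KL y Ky; exists x => //;
    apply: h; rewrite /K' -yE.
- by move=> h; right=> _ [x Lx ->]; apply: h.
Qed.

(** Since 0 lies in N, K contains the kernel of g and is therefore recovered from its image in C. *)
Let step_pre N L : is_submodule N ->
  simple_step N L -> simple_step (pre N) (pre L).
Proof.
move=> sN [sub nsub simp]; split.
- by move=> y; apply: sub.
- move=> h; apply: nsub => z Lz; have [y yz] := surj_g z.
  by have := h y; rewrite /pre yz; apply.
move=> K sK NK KL; pose K' z := exists2 y, K y & z = g y.
have sK' : is_submodule K'.
  split.
  - by exists 0; rewrite ?linear_0 //; apply: submodule0.
  - move=> _ _ [x Kx ->] [y Ky ->]; exists (x + y); rewrite ?linear_D //.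
    exact: submoduleD.
  - move=> r _ [x Kx ->]; exists (r *: x); rewrite ?linear_Z //.
    exact: submoduleZ.
case: (simp K' sK').
- move=> z Nz; have [y yz] := surj_g z; exists y => //.
  by apply: NK; rewrite /pre yz.
- by move=> _ [y Ky ->]; apply: KL.
- by move=> h; left=> y Ky; apply: h; exists y.
move=> h; right=> y Ly; have [y' Ky' gE] := h _ Ly.
rewrite -[y](subrK y') addrC; apply: submoduleD => //.
by apply: NK; rewrite /pre linear_B // gE subrr; apply: submodule0.
Qed.

(** The images under f of a chain of A are followed by the preimages under g of a chain of C; the
    two pieces meet at im f = ker g. *)
Lemma has_length_exact a c :
  has_length A a -> has_length C c -> has_length B (a + c).
Proof.
move=> [N [sN N0 NT stepN]] [L [sL L0 LT stepL]].
pose S i := if (i < a)%N then im (N i) else pre (L (i - a)%N).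
have imNa y : im (N a) y <-> pre (L 0%N) y.
  rewrite /pre; split; first by case=> x _ ->; apply/L0/ker_g; exists x.
  by move/L0/ker_g=> [x ->]; exists x.
exists S; split.
- move=> i ile; rewrite /S; case: ltnP => ia.
    by apply: submodule_im; apply: sN; apply: ltnW.
  by apply: submodule_pre; apply: sL; rewrite leq_subLR.
- have im0 y : im (N 0%N) y <-> y = 0.
    split; first by case=> x /N0 -> ->; rewrite linear_0.
    by move=> ->; exists 0; rewrite ?linear_0 //; apply/N0.
  (* If a = 0 the chain contains no images, and its bottom pre (L 0) equals im (N 0) = 0 by
     [imNa]. *)
  move=> y; rewrite /S; case: ltnP => // a0.
  have {a0} a0 : a = 0%N by case: (a) a0.
  by rewrite -im0 -[in X in im (N X)]a0 imNa a0 subn0.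
- by move=> x; rewrite /S ltnNge leq_addr /= addKn; apply: LT.
move=> i ilt; rewrite /S; case: (ltngtP i.+1 a) => ia.
- by apply/step_im/stepN/ltnW.
- rewrite ltnS in ia; rewrite subSn //.
  have il : (i - a < c)%N by rewrite ltn_subLR.
  by apply: step_pre (stepL _ il); apply: sL; apply: ltnW.
(* At the junction, the step starting from im (N i) ends at pre (L 0), which is im (N a). *)
rewrite -ia subnn.
have il : (i < a)%N by rewrite -ia.
have := step_im (stepN i il).
suff -> : im (N i.+1) = pre (L 0%N) by [].
by apply/predeqP=> y; rewrite ia imNa.
Qed.

End ShortExact.

End ModuleLength.

(** * Exactness properties of extriangles *)

Section Extriangulated.
Variables (R : comPzRingType) (D : extri_data R).
Hypothesis exD : is_extriangulated D.

Let catD := extri_category exD.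
Let funD := extri_bifunctor exD.
Let realD := extri_realization exD.

Lemma mcomp0 (A B C : obj D) (g : hom B C) : g ** (0 : hom A B) = 0.
Proof. exact: linear_0 (mcomp_linearr catD g). Qed.

Lemma mcomp0l (A B C : obj D) (f : hom A B) : (0 : hom B C) ** f = 0.
Proof. exact: linear_0 (mcomp_linearl catD f). Qed.

Lemma push0 (C A A' : obj D) (x : hom A A') : push x (0 : ext C A) = 0.
Proof. exact: linear_0 (push_linearr funD x). Qed.

Lemma is_zeroP (X : obj D) : is_zero X <-> idm X = 0.
Proof.
split=> [ZX | X0 Y]; first exact: (ZX X).1.
split=> [f | g].
  by rewrite -[f](mcompm1 catD) X0 mcomp0.
by rewrite -[g](mcomp1m catD) X0 mcomp0l.
Qed.

Lemma is_iso_inv (X Y : obj D) (f : hom X Y) : is_iso f ->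
  exists2 g : hom Y X, is_iso g & f ** g = idm Y.
Proof. by case=> g [gf fg]; exists g => //; exists f. Qed.

Lemma isomorphic_sym (X Y : obj D) : isomorphic X Y -> isomorphic Y X.
Proof. by case=> f /is_iso_inv[g isog _]; exists g. Qed.

Lemma isomorphic_trans (Y X Z : obj D) :
  isomorphic X Y -> isomorphic Y Z -> isomorphic X Z.
Proof.
case=> f [f' [f'f ff']] [g [g' [g'g gg']]]; exists (g ** f), (f' ** g').
split; rewrite (mcompA catD).
  by rewrite -(mcompA catD f') g'g (mcompm1 catD).
by rewrite -(mcompA catD g) ff' (mcompm1 catD).
Qed.

Lemma is_zero_iso (X Y : obj D) : isomorphic X Y -> is_zero X -> is_zero Y.
Proof.
case=> f [g [_ fg]] ZX; apply/is_zeroP; rewrite -fg.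
by rewrite [f](ZX Y).1 mcomp0l.
Qed.

Lemma biproduct_0l (Z X : obj D) : is_zero Z ->
  is_biproduct (0 : hom Z X) (idm X) (0 : hom X Z) (idm X).
Proof.
move=> /is_zeroP Z0; split; rewrite ?mcomp0 ?mcomp0l ?(mcomp1m catD) ?Z0 //.
by rewrite add0r.
Qed.

Lemma biproduct_0r (Z X : obj D) : is_zero Z ->
  is_biproduct (idm X) (0 : hom Z X) (idm X) (0 : hom X Z).
Proof.
move=> /is_zeroP Z0; split; rewrite ?mcomp0 ?mcomp0l ?(mcomp1m catD) ?Z0 //.
by rewrite addr0.
Qed.

Lemma extriangle_iso (Z X Y : obj D) (f : hom X Y) : is_zero Z -> is_iso f ->
  extriangle (0 : ext Y Z) 0 f.
Proof.
move=> ZZ /is_iso_inv[g isog fg].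
apply: (real_equiv realD (real_split realD (biproduct_0l Y ZZ))).
by exists g; rewrite mcomp0.
Qed.

Section OneExtriangle.
Variables (A B C : obj D) (d : ext C A) (a : hom A B) (b : hom B C).
Hypothesis dab : extriangle d a b.

(** (ET3) for the maps id_A and a out of the split extriangle A -> A -> 0 makes b a factor through a
    zero object. The weak kernel and cokernel properties below come in the same way from X -> X -> 0
    by the dual axiom and from 0 -> X -> X by (ET3). *)
Lemma extriangle_comp0 : b ** a = 0.
Proof.
have [Z ZZ] := has_zero (extri_additive exD).
have [h [<- _]] : exists h : hom Z C, h ** (0 : hom A Z) = b ** a /\
    ext_morphism (0 : ext Z A) d (idm A) h.
  by apply: (extri_ET3 exD) (real_split realD (biproduct_0r A ZZ)) dab _.
by rewrite mcomp0.
Qed.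

Lemma extriangle_kernel (X : obj D) (f : hom X B) :
  b ** f = 0 -> exists g, f = a ** g.
Proof.
move=> bf0; have [Z ZZ] := has_zero (extri_additive exD).
have [g []] : exists g : hom X A, f ** idm X = a ** g /\
    ext_morphism (0 : ext Z X) d g (0 : hom Z C).
  apply: (extri_ET3op exD) (real_split realD (biproduct_0r X ZZ)) dab _.
  by rewrite mcomp0 bf0.
by rewrite (mcompm1 catD) => -> _; exists g.
Qed.

Lemma extriangle_cokernel (X : obj D) (f : hom B X) :
  f ** a = 0 -> exists g, f = g ** b.
Proof.
move=> fa0; have [Z ZZ] := has_zero (extri_additive exD).
have [g []] : exists g : hom C X, g ** b = idm X ** f /\
    ext_morphism d (0 : ext X Z) (0 : hom A Z) g.
  apply: (extri_ET3 exD) dab (real_split realD (biproduct_0l X ZZ)) _.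
  by rewrite mcomp0 fa0.
by rewrite (mcomp1m catD) => <- _; exists g.
Qed.

(** The vanishing of the pullback makes (id_A, c) a morphism of extensions from 0 to d; its
    completion A (+) X -> B, restricted to X, lifts c. *)
Lemma extriangle_lift (X : obj D) (c : hom X C) :
  pull c d = 0 -> exists g, b ** g = c.
Proof.
move=> c0.
have [P [i1 [i2 [p1 [p2 bi]]]]] := has_biproducts (extri_additive exD) A X.
have [g [_ cg]] : exists g : hom P B, g ** i1 = a ** idm A /\ c ** p2 = b ** g.
  apply: (real_morphism realD) (real_split realD bi) dab _.
  by rewrite /ext_morphism push0 c0.
exists (g ** i2).
by rewrite (mcompA catD) -cg -(mcompA catD) (biprod_22 bi) (mcompm1 catD).
Qed.

(* Composing [a] with the inflation realizing [e] (ET4) yields an extriangle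
   C -> E -> X realizing [push b e], which splits when [push b e] vanishes;
   pulling back along a section of E -> X expresses [e] through [a]. *)
Lemma extriangle_ext_exact (X : obj D) (e : ext X B) :
  push b e = 0 -> exists e' : ext X A, e = push a e'.
Proof.
move=> be0; have [Y [x [y exy]]] := real_ex realD e.
have [E [h' [d3 [u [v [_ _ uv _ ade]]]]]] := extri_ET4 exD dab exy.
have [Z ZZ] := has_zero (extri_additive exD).
have [P [i1 [i2 [p1 [p2 bi]]]]] := has_biproducts (extri_additive exD) C X.
rewrite be0 in uv.
have [g [_ _ vg]] := real_uniq realD (real_split realD bi) uv.
have vs : v ** (g ** i2) = idm X by rewrite (mcompA catD) vg (biprod_22 bi).
exists (pull (g ** i2) d3).
by rewrite (push_pull funD) ade -(pullM funD) vs (pull1 funD).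
Qed.

(** A zero end term forces d = 0, and the extriangle is then equivalent to the split one. The next
    lemma is dual. *)
Lemma is_iso_deflation : is_zero A -> is_iso b.
Proof.
move=> ZA; have d0 : d = 0.
  rewrite -[d](push1 funD) (is_zeroP A).1 //.
  exact: linear_0 (push_linearl funD d).
have dab0 := dab; rewrite d0 in dab0.
have split0 := real_split realD (biproduct_0l C ZA).
have [g [isog _ <-]] := real_uniq realD dab0 split0.
by rewrite (mcomp1m catD).
Qed.

Lemma is_iso_inflation : is_zero C -> is_iso a.
Proof.
move=> ZC; have d0 : d = 0.
  rewrite -[d](pull1 funD) (is_zeroP C).1 //.
  exact: linear_0 (pull_linearl funD d).
have dab0 := dab; rewrite d0 in dab0.
have split0 := real_split realD (biproduct_0r A ZC).
have [g [isog <- _]] := real_uniq realD split0 dab0.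
by rewrite (mcompm1 catD).
Qed.

End OneExtriangle.

(** * Filtered objects: induction and closure under extensions *)

Definition extension (A B C : obj D) : Prop :=
  exists (d : ext C A) (a : hom A B) (b : hom B C), extriangle d a b.

Lemma filt0 (X : obj D -> Prop) M : is_zero M -> filt X M.
Proof.
by move=> ZM; exists 0%N, (fun _ => M), (fun _ => M); split=> // i; case: i.
Qed.

Lemma filtS (X : obj D -> Prop) A B C :
  filt X A -> X C -> extension A B C -> filt X B.
Proof.
move=> [t [N [F [N0 Nt stepN]]]] XC ABC.
exists t.+1, (fun i => if (i <= t)%N then N i else B),
  (fun i => if (i <= t)%N then F i else C); split=> //; first by rewrite ltnn.
case=> // i /andP[_]; rewrite ltnS => it; rewrite /= it.
case: ltngtP it => // [it _|-> _]; first exact: stepN.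
by rewrite Nt.
Qed.

(** Induction on the steps of a filtration; the inductive step also receives [filt X A], from which
    [filt_inv] is read off. *)
Lemma filt_ind (X : obj D -> Prop) (T : obj D -> Prop) :
  (forall M, is_zero M -> T M) ->
  (forall A B C, filt X A -> T A -> X C -> extension A B C -> T B) ->
  forall M, filt X M -> T M.
Proof.
move=> T0 TS M [t [N [F [N0 <- stepN]]]].
suff IH i : (i <= t)%N -> filt X (N i) /\ T (N i) by case: (IH t).
elim: i => [_|i IH it]; first by split; [apply: filt0 | apply: T0].
have [fi Ti] := IH (ltnW it); have [XF e] := stepN i.+1 it.
by split; [apply: filtS fi XF e | apply: TS fi Ti XF e].
Qed.

Lemma filt_inv (X : obj D -> Prop) M : filt X M ->
  is_zero M \/ exists A C, [/\ filt X A, X C & extension A M C].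
Proof.
elim/filt_ind: M / => [M|A B C fA _ XC ABC]; first by left.
by right; exists A, C.
Qed.

Lemma filt_monotone (X Y : obj D -> Prop) :
  (forall M, X M -> Y M) -> forall M, filt X M -> filt Y M.
Proof.
move=> XY; apply: filt_ind => [M|A B C _ fA XC]; first exact: filt0.
exact: filtS fA (XY _ XC).
Qed.

Lemma filt_one (X : obj D -> Prop) M : X M -> filt X M.
Proof.
have [Z ZZ] := has_zero (extri_additive exD) => XM.
apply: filtS (filt0 X ZZ) XM _; exists 0, 0, (idm M).
exact: (real_split realD (biproduct_0l M ZZ)).
Qed.

Lemma filt_iso (X : obj D -> Prop) M M' :
  isomorphic M M' -> filt X M -> filt X M'.
Proof.
move=> isoM /filt_inv[ZM|]; first by apply: filt0; apply: is_zero_iso ZM.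
case: isoM => f isof [A [C [fA XC [d [a [b dab]]]]]].
have [g [gf fg]] := isof.
apply: filtS fA XC _; exists d, (f ** a), (b ** g).
apply: (real_equiv realD) dab _; exists f; split=> //.
by rewrite -(mcompA catD) gf (mcompm1 catD).
Qed.

(** Induction on the filtration of C. If F is the last factor of C and C' the preceding term, the
    dual of (ET4) presents B as an extension of F by some E, and E as an extension of C' by A. *)
Lemma filt_extension (X : obj D -> Prop) A B C :
  filt X A -> filt X C -> extension A B C -> filt X B.
Proof.
move=> fA fC; elim/filt_ind: C / fC A B fA => [C ZC A B fA|].
  move=> [d [a [b dab]]]; apply: filt_iso fA.
  by exists a; apply: is_iso_inflation dab ZC.
move=> C' C F _ IH XF [d1 [f' [f df]]] A B fA [d2 [g' [g dg]]].
have [E [h' [d3 [u [v [dE _ dF _ _]]]]]] := extri_ET4op exD df dg.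
apply: filtS (IH _ _ fA _) XF _; first by exists (pull f' d2), v, u; exact: dF.
by exists d3, h', (f ** g).
Qed.

End Extriangulated.

(** * Extension-closed full subcategories *)

Section FullSubcategory.
Variables (R : comPzRingType) (D : extri_data R) (P : obj D -> Prop).
Hypothesis exD : is_extriangulated D.
Hypothesis P0 : exists2 Z, is_zero Z & P Z.
Hypothesis P_ext : forall A B C, P A -> P C -> extension A B C -> P B.

(** Only axioms that produce objects need an argument. Biproducts are split extensions, and the
    object E of (ET4) or its dual is the middle term of an extriangle with both ends in P. *)
Lemma full_sub_extriangulated : is_extriangulated (full_sub P).
Proof.
case: exD => [[cA c1 c2 c3 c4] [_ bip] [f1 f2 f3 f4 f5 f6 f7 f8 f9]
  [r1 r2 r3 r4 r5 r6] e3 e3o e4 e4o].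
split.
- by split=> *; [apply: cA | apply: c1 | apply: c2 | apply: c3 | apply: c4].
- split.
    have [Z ZZ PZ] := P0; exists (exist _ Z PZ) => Y; exact: (ZZ (sval Y)).
  move=> [A PA] [B PB]; have [S [i1 [i2 [p1 [p2 bi]]]]] := bip A B.
  have PS : P S by apply: (P_ext PA PB); exists 0, i1, p2; apply: r5 bi.
  by exists (exist _ S PS), i1, i2, p1, p2; case: bi.
- by split=> *; [apply: f1 | apply: f2 | apply: f3 | apply: f4 | apply: f5
    | apply: f6 | apply: f7 | apply: f8 | apply: f9].
- split.
  + move=> [A PA] [C PC] d; have [B [a [b dab]]] := r1 A C d.
    have PB : P B by apply: (P_ext PA PC); exists d, a, b.
    by exists (exist _ B PB), a, b.
  + by move=> A B B' C d a b a' b'; apply: r2.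
  + by move=> A B B' C d a b a' b'; apply: r3.
  + by move=> A B C A' B' C' d a b d' a' b' f h; apply: r4.
  + move=> A C S i1 i2 p1 p2 [b1 b2 b3 b4 b5].
    by apply: (r5 _ _ _ i1 i2 p1 p2).
  + move=> A B C A' B' C' d a b d' a' b' SA SB SC iA iA' pA pA'
      iB iB' pB pB' iC iC' pC pC' [? ? ? ? ?] [? ? ? ? ?] [? ? ? ? ?].
    by apply: r6.
- by move=> A B C A' B' C' d a b d' a' b' f g; apply: e3.
- by move=> A B C A' B' C' d a b d' a' b' f g; apply: e3o.
- move=> [A PA] [B PB] [C PC] [D' PD] [F PF] f f' d1 g g' d2 h1 h2.
  have [E [h' [d3 [u [v [x1 x2 x3 x4 x5]]]]]] := e4 _ _ _ _ _ _ _ _ _ _ _ h1 h2.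
  have PE : P E by apply: (P_ext PD PF); exists (push f' d2), u, v.
  by exists (exist _ E PE), h', d3, u, v.
- move=> [A PA] [B PB] [C PC] [D' PD] [F PF] f f' d1 g g' d2 h1 h2.
  have [E [h' [d3 [u [v [x1 x2 x3 x4 x5]]]]]] := e4o _ _ _ _ _ _ _ _ _ _ _ h1 h2.
  have PE : P E by apply: (P_ext PF PD); exists (pull f d2), v, u.
  by exists (exist _ E PE), h', d3, u, v.
Qed.

End FullSubcategory.

(** * Multiplicities determined by a triangular system *)

Lemma sum_count_mem (I : finType) (s : seq I) (F : I -> nat) :
  (\sum_(k <- s) F k = \sum_k count_mem k s * F k)%N.
Proof.
elim: s => [|x s IH]; first by rewrite big_nil big1.
rewrite [RHS](eq_bigr (fun k => (x == k) * F k + count_mem k s * F k)%N).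
  2: by move=> k _; rewrite -mulnDl.
rewrite big_cons IH big_split /=; congr addn.
rewrite (bigD1 x) //= eqxx mul1n big1 ?addn0 // => k kx.
by rewrite eq_sym (negPf kx).
Qed.

(** The multiplicities solve a triangular linear system, treated by descending induction on j: terms
    with k < j vanish, those with k > j already agree, and the diagonal entry can be cancelled. *)
Lemma triangular_perm_eq n (c : 'I_n -> 'I_n -> nat) (s s' : seq 'I_n) :
  (forall j k : 'I_n, (k < j)%N -> c j k = 0%N) ->
  (forall j, (0 < c j j)%N) ->
  (forall j, \sum_(k <- s) c j k = \sum_(k <- s') c j k)%N ->
  perm_eq s s'.
Proof.
move=> c0 cpos eqs.
(* The bound m on n - j drives the descent; m = 0 is void because j < n. *)
suff IH m (j : 'I_n) : (n - j <= m)%N -> count_mem j s = count_mem j s'.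
  by apply/allP=> k _; apply/eqP; apply: (IH n); apply: leq_subr.
elim: m j => [|m IH] j jm.
  by move: (ltn_ord j); rewrite -subn_gt0 ltnNge jm.
have := eqs j; rewrite (sum_count_mem s) (sum_count_mem s').
rewrite (bigD1 j) //= [RHS](bigD1 j) //=.
rewrite (eq_bigr (fun k => count_mem k s' * c j k)%N) => [/addIn/eqP|k kj].
  by rewrite eqn_pmul2r // => /eqP.
case: (ltngtP k j) kj => [kj _|jk _|/val_inj ->]; last by rewrite eqxx.
  by rewrite c0 // !muln0.
rewrite IH // -ltnS; apply: leq_trans jm.
exact: ltn_sub2l (ltn_ord j) jk.
Qed.

(** * The functors Hom(Q_i, -) when every object is filtered *)

Section StratifiedCategory.
Variables (R : comPzRingType) (D : extri_data R) (n : nat).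
(** Here [D] stands for F(Phi) itself, which contains the Q_i, and [L i X] is the R-length of
    Hom(Q_i, X). *)
Variables (Phi Q : 'I_n -> obj D) (L : 'I_n -> obj D -> nat).
Hypothesis exD : is_extriangulated D.
Hypothesis filtD : forall M : obj D, filt (fun X => exists i, X = Phi i) M.
Hypothesis Phi_neq0 : forall i, ~ is_zero (Phi i).
Hypothesis S1 : forall i j : 'I_n, (i < j)%N ->
  forall f : hom (Phi j) (Phi i), f = 0.
Hypothesis psQ : PS1 Phi Q.
Hypothesis coverQ : forall i : 'I_n,
  exists (K : obj D) (k : hom K (Q i)) (q : hom (Q i) (Phi i))
    (eta : ext (Phi i) K),
    @PS2_extriangle R D n Phi Q i K k q eta /\ right_minimal q.
Hypothesis lexQ : forall i, left_exact (fun (X Y : obj D) (f : hom X Y)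
  (g : hom (Q i) X) => f ** g).
Hypothesis lengthQ : forall i X, has_length (hom (Q i) X) (L i X).

Let catD := extri_category exD.

(** By exactness of E(Q_i, -) at the middle term, (PS1) propagates along each filtration step. *)
Lemma ext_projective0 i M (e : ext (Q i) M) : e = 0.
Proof.
move: M (filtD M) e; apply: filt_ind.
- move=> M ZM e.
  rewrite -[e](push1 (extri_bifunctor exD)) (is_zeroP exD M).1 //.
  exact: linear_0 (push_linearl (extri_bifunctor exD) e).
- move=> A B _ _ IH [j ->] [d [a [b dab]]] e.
  have [e' ->] := extriangle_ext_exact exD dab (psQ (push b e)).
  by rewrite (IH e') (push0 exD).
Qed.

Lemma projective_lift i A B C (d : ext C A) (a : hom A B) (b : hom B C)
  (f : hom (Q i) C) : extriangle d a b -> exists g, b ** g = f.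
Proof.
by move=> dab; apply: (extriangle_lift exD dab); apply: ext_projective0.
Qed.

(** Hom(Q_i, -) yields a short exact sequence: injectivity is left exactness, surjectivity is
    lifting, and middle exactness is the weak kernel property. *)
Lemma length_extriangle i A B C (d : ext C A) (a : hom A B) (b : hom B C) :
  extriangle d a b -> L i B = (L i A + L i C)%N.
Proof.
move=> dab; apply: has_length_uniq (lengthQ i B) _.
apply: (@has_length_exact _ _ _ _ (fun g : hom (Q i) A => a ** g)
  (fun g : hom (Q i) B => b ** g)) => //.
- exact: (mcomp_linearr catD a).
- exact: (mcomp_linearr catD b).
- exact: lexQ dab.
- by move=> f; apply: projective_lift dab.
- move=> f; split; first exact: extriangle_kernel dab _ _.
  case=> g ->.
  by rewrite (mcompA catD) (extriangle_comp0 exD dab) (mcomp0l exD).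
Qed.

Lemma length_zero i M : is_zero M -> L i M = 0%N.
Proof.
move=> ZM; apply: has_length_uniq (lengthQ i M) _.
by apply: has_length0; apply: (ZM (Q i)).2.
Qed.

Lemma length_iso i M M' : isomorphic M M' -> L i M = L i M'.
Proof.
case=> f isof; have [Z ZZ] := has_zero (extri_additive exD).
by rewrite (length_extriangle i (extriangle_iso exD ZZ isof)) length_zero.
Qed.

Lemma hom_filt_eq0 (X : obj D -> Prop) Y M :
  (forall N, X N -> forall f : hom N Y, f = 0) ->
  filt X M -> forall f : hom M Y, f = 0.
Proof.
move=> X0; move: M; apply: filt_ind => [M ZM|A B C _ IH XC [d [a [b dab]]] f].
  exact: (ZM Y).1.
have [g ->] := extriangle_cokernel exD dab (IH (f ** a)).
by rewrite (X0 C XC g) (mcomp0l exD).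
Qed.

(** The factors Phi_l of K_j have l > j > k, so by (S1) f vanishes on K_j and factors through q_j; a
    second use of (S1) kills the factor Phi_j -> Phi_k. *)
Lemma hom_projective_eq0 (j k : 'I_n) (f : hom (Q j) (Phi k)) :
  (k < j)%N -> f = 0.
Proof.
move=> kj; have [K [u [q [eta [[euq fK] _]]]]] := coverQ j.
have [|g ->] := extriangle_cokernel exD euq (f := f).
  apply: hom_filt_eq0 fK _ => _ [l jl ->]; apply: S1.
  exact: ltn_trans jl.
by rewrite (S1 kj g) (mcomp0l exD).
Qed.

(** A nonzero map from Q_j to the last factor Phi_j would lift to M. The index set X allows use
    within a descending induction, where such maps are known only for the larger indices. *)
Lemma zero_of_hom_projective (X : 'I_n -> Prop) M :
  (forall j, X j -> exists f : hom (Q j) (Phi j), f <> 0) ->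
  filt (fun N => exists2 j, X j & N = Phi j) M ->
  (forall j (f : hom (Q j) M), f = 0) -> is_zero M.
Proof.
move=> X0 /(filt_inv)[//|[A [_ [_ [j Xj ->] [d [a [b dab]]]]]]] M0.
have [f] := X0 j Xj; case; have [g <-] := projective_lift f dab.
by rewrite (M0 j g) (mcomp0 exD).
Qed.

(* If q_i = 0 then Q_i = 0 by minimality, so left exactness kills all maps from
   the Q_j to K_i; as K_i is built from the Phi_j with j > i, it vanishes by
   induction, and so does Phi_i. *)
Lemma hom_projective_neq0 j : exists f : hom (Q j) (Phi j), f <> 0.
Proof.
suff IH m (i : 'I_n) : (n - i <= m)%N -> exists f : hom (Q i) (Phi i), f <> 0.
  by apply: (IH n); apply: leq_subr.
elim: m i => [|m IH] i im.
  by move: (ltn_ord i); rewrite -subn_gt0 ltnNge im.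
have [K [k [q [eta [[ekq fK] minq]]]]] := coverQ i.
have [q0|] := EM (q = 0); last by exists q.
have ZQ : is_zero (Q i).
  apply/(is_zeroP exD); have [|g [gf _]] := minq 0.
    by rewrite q0 (mcomp0 exD).
  by rewrite -gf (mcomp0 exD).
have ZK : is_zero K.
  apply: zero_of_hom_projective fK _ => [l il|l f].
    by apply: IH; rewrite -ltnS; apply: leq_trans im; apply: ltn_sub2l.
  by apply: (lexQ (i := l) ekq); rewrite [LHS](ZQ _).2 [RHS](ZQ _).2.
case: (@Phi_neq0 i); apply: (is_zero_iso exD) ZQ.
by exists q; apply: is_iso_deflation ekq ZK.
Qed.

Lemma is_zero_of_hom M : (forall j (f : hom (Q j) M), f = 0) -> is_zero M.
Proof.
apply: (zero_of_hom_projective (X := fun _ => True)) => [j _|].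
  exact: hom_projective_neq0.
by apply: filt_monotone (filtD M) => _ [j ->]; exists j.
Qed.

(** * Multisets of factors, simple objects and the Jordan-Hölder property *)

(** The multiset of factors as seen by the lengths alone, without a chosen filtration, so that
    contents of the ends of an extriangle concatenate. *)
Definition content (M : obj D) (s : seq 'I_n) : Prop :=
  forall j, L j M = (\sum_(k <- s) L j (Phi k))%N.

Lemma content_perm M s s' : content M s -> content M s' -> perm_eq s s'.
Proof.
move=> Ms Ms'; apply: (@triangular_perm_eq _ (fun j k => L j (Phi k))).
- move=> j k kj; apply: has_length_uniq (lengthQ j _) _.
  by apply: has_length0 => f; apply: hom_projective_eq0.
- move=> j; have [f f0] := hom_projective_neq0 j.
  rewrite lt0n; apply/eqP=> L0; apply: f0; apply: has_length_eq0.
  by rewrite -L0.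
- by move=> j; rewrite -Ms -Ms'.
Qed.

Lemma content_ex M : exists s, content M s.
Proof.
move: M (filtD M); apply: filt_ind => [M ZM|A B _ _ [s As] [k ->]].
  by exists [::] => j; rewrite big_nil length_zero.
move=> [d [a [b dab]]]; exists (k :: s) => j.
by rewrite (length_extriangle j dab) big_cons As addnC.
Qed.

Lemma content_nil M : content M [::] -> is_zero M.
Proof.
move=> M0; apply: is_zero_of_hom => j f; apply: has_length_eq0.
by have := lengthQ j M; rewrite M0 big_nil.
Qed.

(** The contents of A and C together form the one-element list of i, so one of them is empty and the
    corresponding object is zero. *)
Lemma simple_Phi i : simple (Phi i).
Proof.
split=> // A C d a b dab.
have [[s As] [s' Cs']] := (content_ex A, content_ex C).
have : perm_eq (s ++ s') [:: i].
  apply: (@content_perm (Phi i)) => j; last by rewrite big_seq1.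
  by rewrite (length_extriangle j dab) big_cat As Cs'.
move/perm_size; case: s As => [/content_nil ZA _|x s _].
  by left; apply: (ZA _).1.
case: s' Cs' => [/content_nil ZC _|y s' _].
  by right; apply: is_iso_inflation dab ZC.
by rewrite /= size_cat /= addnS.
Qed.

(** Let b : S -> Phi_i be the last deflation of a filtration. If a = 0, left exactness gives A = 0
    and b is an isomorphism. If a is an isomorphism then b = 0, although a nonzero map Q_i -> Phi_i
    lifts through b. *)
Lemma simple_iso S : simple S -> exists i, isomorphic S (Phi i).
Proof.
case=> nZ simS.
have [|[A [_ [_ [i ->] [d [a [b dab]]]]]]] := filt_inv (filtD S); first by [].
exists i, b; apply: (is_iso_deflation exD dab).
apply: is_zero_of_hom => j f.
case: (simS _ _ _ _ _ dab) => [a0|[a' [_ aa']]].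
  by apply: (lexQ (i := j) dab); rewrite a0 !(mcomp0l exD).
have [q] := hom_projective_neq0 i; case.
have [g <-] := projective_lift q dab.
rewrite -[b](mcompm1 catD) -aa' (mcompA catD) (extriangle_comp0 exD dab).
by rewrite !(mcomp0l exD).
Qed.

Lemma length_filtration (X : obj D -> Prop) M t N F j :
  filtration X M t N F -> L j M = (\sum_(i < t) L j (F i.+1))%N.
Proof.
move=> [N0 <- stepN].
suff IH i : (i <= t)%N -> L j (N i) = (\sum_(l < i) L j (F l.+1))%N.
  exact: IH.
elim: i => [_|i IH it]; first by rewrite big_ord0 length_zero.
have [_ [d [a [b dab]]]] := stepN i.+1 it.
by rewrite (length_extriangle j dab) big_ord_recr -(IH (ltnW it)).
Qed.

Lemma composition_series_content M t N F : composition_series M t N F ->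
  exists2 l : 'I_t -> 'I_n, forall i : 'I_t, isomorphic (F i.+1) (Phi (l i))
    & content M [tuple l i | i < t].
Proof.
move=> csM; have [_ _ stepN] := csM.
have /choice[l lP] : forall i : 'I_t, exists k, isomorphic (F i.+1) (Phi k).
  by move=> i; apply: simple_iso; have [] := stepN i.+1 (ltn_ord i).
exists l => // j; rewrite (length_filtration j csM) big_tuple.
by apply: eq_bigr => i _; rewrite tnth_mktuple; apply: length_iso.
Qed.

Lemma stratified_jordan_holder : jordan_holder D.
Proof.
move=> M t t' N F N' F' /composition_series_content[l lP Ml].
move=> /composition_series_content[l' lP' Ml'].
have perm_l := content_perm Ml Ml'.
have tt' : t = t' by have := perm_size perm_l; rewrite !size_tuple.
subst t'; split=> //; have /tuple_permP[p lp] := perm_l.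
exists p => i; apply: (isomorphic_trans exD (lP i)).
(* Both index lists are contents of M, hence permutations of each other; entry i is compared. *)
have -> : l i = l' (p i).
  have /(congr1 (fun s => nth (l i) s i)) := lp.
  by rewrite -!tnth_nth !tnth_mktuple.
exact: isomorphic_sym.
Qed.

(** A filtration by the Phi_i is a composition series because they are simple; its length is the
    bound, by the Jordan-Hölder property. *)
Lemma stratified_length : is_length D.
Proof.
move=> M; have csM : exists t N F, composition_series M t N F.
  have [|] := filt_monotone (Y := simple (D := D)) _ (filtD M).
    by move=> _ [i ->]; apply: simple_Phi.
  by move=> t [N [F csM]]; exists t, N, F.
split=> //; have [t [N [F csM1]]] := csM; exists t => t' N' F' csM'.
have [-> _] := stratified_jordan_holder csM1 csM'.
exact: leqnn.
Qed.

End StratifiedCategory.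

(** * Transfer to the subcategory F(Phi) *)

Section FiltSub.
Variables (R : comPzRingType) (D : extri_data R).
Variables (n : nat) (Phi : 'I_n -> obj D).
Hypothesis exD : is_extriangulated D.

Lemma filt_sub_extriangulated : is_extriangulated (filt_sub Phi).
Proof.
apply: (full_sub_extriangulated exD) => [|A B C fA fC].
  have [Z ZZ] := has_zero (extri_additive exD); exists Z => //.
  exact: filt0.
exact: filt_extension.
Qed.

Lemma filt_Phi i : filt (fun M => exists i, M = Phi i) (Phi i).
Proof. by apply: (filt_one exD); exists i. Qed.

Definition sub_Phi i : obj (filt_sub Phi) := exist _ (Phi i) (filt_Phi i).

(** All terms of the filtration lie in F(Phi) again. The induction ranges over every M above N,
    since an object of the subcategory carries its membership proof; T covers both all indices and
    the indices j > i occurring in K_i. *)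
Lemma filt_sub_Phi (T : 'I_n -> Prop) (M : obj (filt_sub Phi)) :
  filt (fun N => exists2 j, T j & N = Phi j) (sval M) ->
  filt (fun N => exists2 j, T j & N = sub_Phi j) M.
Proof.
move: M; suff IH N : filt (fun N => exists2 j, T j & N = Phi j) N ->
    forall M : obj (filt_sub Phi), sval M = N ->
      filt (fun N => exists2 j, T j & N = sub_Phi j) M.
  by move=> M /IH; apply.
move: N; apply: filt_ind => [N ZN M eqN|].
  by apply: filt0 => Y; rewrite -eqN in ZN; apply: (ZN (sval Y)).
move=> A B C fA IH [j Tj ->] ABC [B' PB] /= eqB.
subst B'; have PA : filt (fun M => exists i, M = Phi i) A.
  by apply: filt_monotone fA => _ [i _ ->]; exists i.
apply: (@filtS _ (filt_sub Phi) _ (exist _ A PA) _ (sub_Phi j)).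
- exact: IH.
- by exists j.
- exact: ABC.
Qed.

Lemma filt_subD (M : obj (filt_sub Phi)) :
  filt (fun N => exists i, N = sub_Phi i) M.
Proof.
apply: (filt_monotone (X := fun N => exists2 j, True & N = sub_Phi j)).
  by move=> _ [j _ ->]; exists j.
apply: filt_sub_Phi; apply: filt_monotone (svalP M) => _ [j ->].
by exists j.
Qed.

End FiltSub.

Theorem theorem2 (R : comPzRingType) (D : extri_data R) (n : nat)
    (Phi Q : 'I_n -> obj D) :
  artinian_ring R ->
  is_artin_extriangulated D ->
  minimal_projective_stratifying_system Phi Q ->
  (forall i : 'I_n, hom_left_exact Phi (Q i)) ->
  [/\ forall i : 'I_n,
        exists2 S : obj (filt_sub Phi), sval S = Phi i & simple S,
      forall S : obj (filt_sub Phi),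
        simple S -> exists i : 'I_n, isomorphic (sval S) (Phi i),
      is_extriangulated (filt_sub Phi),
      is_length (filt_sub Phi)
    & jordan_holder (filt_sub Phi)].
Proof.
move=> _ [exD _ finhom _] [[strat psQ _] coverQ] lexQ.
have exS := filt_sub_extriangulated Phi exD.
pose Phi' := sub_Phi Phi exD.
(* (PS2) presents Q_i as an extension of Phi_i by K_i. *)
have filtQ i : filt (fun M => exists i, M = Phi i) (Q i).
  have [K [k [q [eta [[ekq fK] _]]]]] := coverQ i.
  apply: (filt_extension exD (A := K) (C := Phi i)).
  - by apply: filt_monotone fK => _ [j _ ->]; exists j.
  - exact: filt_Phi.
  - by exists eta, k, q.
pose Q' i : obj (filt_sub Phi) := exist _ (Q i) (filtQ i).
have Phi_neq0 i : ~ is_zero (Phi' i).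
  (* Being zero in F(Phi) tests fewer objects than in the ambient category; the criterion id = 0 is
     the same in both. *)
  case: (strat_indec strat i) => nZ _ /(is_zeroP exS) Z; apply: nZ.
  exact/(is_zeroP exD).
have S1 (i j : 'I_n) : (i < j)%N -> forall f : hom (Phi' j) (Phi' i), f = 0.
  exact: strat_S1 strat i j.
have psQ' : PS1 Phi' Q' by move=> i j d; apply: (psQ i j d).
have coverQ' (i : 'I_n) : exists (K : obj (filt_sub Phi)) (k : hom K (Q' i))
    (q : hom (Q' i) (Phi' i)) (eta : ext (Phi' i) K),
    @PS2_extriangle R _ n Phi' Q' i K k q eta /\ right_minimal q.
  have [K [k [q [eta [[ekq fK] minq]]]]] := coverQ i.
  have PK : filt (fun M => exists i, M = Phi i) K.
    by apply: filt_monotone fK => _ [j _ ->]; exists j.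
  exists (exist _ K PK), k, q, eta; split=> //; split=> //.
  exact: (filt_sub_Phi exD (M := exist _ K PK)).
(* Finite length only asserts that some length exists; choice over the pairs (i, X) turns it into a
   function. *)
have /choice[L LP] : forall iX : 'I_n * obj (filt_sub Phi), exists l,
    has_length (hom (Q' iX.1) iX.2) l.
  by move=> [i X]; apply: finhom.
pose lengthQ i X := LP (i, X).
split=> //.
- move=> i; exists (Phi' i) => //.
  exact: (simple_Phi exS (filt_subD exD) Phi_neq0 S1 psQ' coverQ' lexQ lengthQ).
- move=> S simS.
  have [i [f isof]] :=
    simple_iso exS (filt_subD exD) Phi_neq0 psQ' coverQ' lexQ simS.
  by exists i, f.
- exact: (stratified_length exS (filt_subD exD) Phi_neq0 S1 psQ' coverQ' lexQ
    lengthQ).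
- exact: (stratified_jordan_holder exS (filt_subD exD) Phi_neq0 S1 psQ' coverQ'
    lexQ lengthQ).
Qed.
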